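(* Let $k$ be an algebraically closed field of characteristic $0$ and $R=k\langle x,y\rangle/(xy-yx-y^2)$. Up to isomorphism (choosing a basis in which the image of $y$ is in Jordan normal form), the finite dimensional representations of $R$ are exactly the following pairs $(X,Y)=(\rho(x),\rho(y))$ of $n\times n$ matrices. The matrix $Y$ is block diagonal, $Y=\mathrm{diag}(J_{n_1},\dots,J_{n_m})$, where $J_{n_i}$ is the nilpotent Jordan block of size $n_i$ and $n_1+\dots+n_m=n$; and $X=(A_{ij})_{1\le i,j\le m}$, partitioned into blocks $A_{ij}$ of size $n_i\times n_j$ according to the Jordan blocks of $Y$, where each diagonal block has the form $A_{ii}=X^0_{n_i}+T_i$ with $T_i$ an arbitrary upper diagonal (square) Toeplitz matrix, and each off-diagonal block $A_{ij}$, $i\ne j$, is an arbitrary upper diagonal rectangular Toeplitz matrix.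
   Context: $J_p$ denotes the $p\times p$ matrix with $1$'s on the first upper diagonal (entries $(i,i+1)$) and zeros elsewhere. $X^0_p$ denotes the $p\times p$ matrix whose first upper diagonal is $(0,1,2,\dots,p-2)$, i.e. $(X^0_p)_{i,i+1}=i-1$, with all other entries zero. A $p\times q$ matrix $(a_{st})$ is an upper diagonal (rectangular) Toeplitz matrix if $a_{st}$ depends only on $t-s$ and all entries strictly below the upper diagonal of maximal length vanish, i.e. $a_{st}=0$ whenever $t-s<\max(0,q-p)$. An $n$-dimensional representation of $R$ is an algebra homomorphism $\rho:R\to M_n(k)$, equivalently a pair $(X,Y)$ of $n\times n$ matrices with $XY-YX=Y^2$.
   Formalization: The diagonal blocks are taken as A_ii = T_i − X^0_{n_i} instead of X^0_{n_i} + T_i, because [X^0_p, J_p] = −J_p^2, so the printed form fails XY − YX = Y^2 once some n_i ≥ 3. *)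

(* Defs.v *)
From HB Require Import structures.
From mathcomp Require Import all_boot all_order all_algebra.
From mathcomp Require Import generic_quotient ring_quotient.
From mathcomp.finmap Require Import finmap.
From mathcomp.classical Require boolp.
From mathcomp.multinomials Require Import monalg.

Set Implicit Arguments.
Unset Strict Implicit.
Unset Printing Implicit Defensive.

Import Order.TTheory GRing.Theory Num.Theory.
Local Open Scope ring_scope.

(* The algebra R = k<x, y> / (xy - yx - y^2).                                 *)

Section FreeAlgebra.
Variable k : fieldType.

(* Noncommutative polynomials, as the monoid algebra of the free monoid on    *)
(* two letters; the letters true and false stand for x and y.                 *)
Definition free_alg := {malg k[{fmonom bool}]}.
HB.instance Definition _ := GRing.Lalgebra.on free_alg.

Definition free_x : free_alg := << fmu true >>.
Definition free_y : free_alg := << fmu false >>.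
Definition jordan_relator : free_alg :=
  free_x * free_y - free_y * free_x - free_y ^+ 2.

(* The two-sided ideal generated by the relator.                              *)
Inductive in_jordan_ideal : free_alg -> Prop :=
| in_jordan_ideal0 : in_jordan_ideal 0
| in_jordan_idealD f g :
    in_jordan_ideal f -> in_jordan_ideal g -> in_jordan_ideal (f + g)
| in_jordan_idealG a b : in_jordan_ideal (a * jordan_relator * b).

Definition jordan_ideal : {pred free_alg} :=
  fun f => boolp.asbool (in_jordan_ideal f).

Lemma jordan_idealP f : reflect (in_jordan_ideal f) (f \in jordan_ideal).
Proof. exact: boolp.asboolP. Qed.

Lemma jordan_idealMl a f : f \in jordan_ideal -> a * f \in jordan_ideal.
Proof.
move=> /jordan_idealP If; apply/jordan_idealP.
elim: If => [|f1 g1 _ I1 _ I2|b c]; first by rewrite mulr0; constructor.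
  by rewrite mulrDr; constructor.
by rewrite !mulrA; constructor.
Qed.

Lemma jordan_idealMr a f : f \in jordan_ideal -> f * a \in jordan_ideal.
Proof.
move=> /jordan_idealP If; apply/jordan_idealP.
elim: If => [|f1 g1 _ I1 _ I2|b c]; first by rewrite mul0r; constructor.
  by rewrite mulrDl; constructor.
by rewrite -mulrA; constructor.
Qed.

Lemma jordan_ideal_zmod_closed : zmod_closed jordan_ideal.
Proof.
split=> [|f g If Ig]; first by apply/jordan_idealP; constructor.
have /jordan_idealP INg: - g \in jordan_ideal.
  by rewrite -mulN1r; apply: jordan_idealMl.
by apply/jordan_idealP; constructor=> //; apply/jordan_idealP.
Qed.
HB.instance Definition _ :=
  GRing.isZmodClosed.Build free_alg jordan_ideal jordan_ideal_zmod_closed.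

(* Scalars are central in the free algebra; monalg only records this for      *)
(* commutative monoids.                                                       *)
Lemma free_scalerAr c (f g : free_alg) : c *: (f * g) = f * (c *: g).
Proof.
rewrite (malgMEw (fsubset_refl _) (msuppZ_le c g)) scaler_sumr.
apply: eq_bigr => m _; rewrite scaler_sumr; apply: eq_bigr => m' _.
by apply/malgP=> m''; rewrite mcoeffZ !mcoeffU mcoeffZ mulrCA mulrnAr.
Qed.
HB.instance Definition _ :=
  GRing.Lalgebra_isAlgebra.Build k free_alg free_scalerAr.

Section Lift.
Variables (A : algType k) (a b : A).

Definition word_eval (w : {fmonom bool}) : A :=
  \prod_(i <- w) (if i then a else b).

Lemma word_eval_mmorphism : mmorphism word_eval.
Proof.
split=> [w1 w2|]; rewrite /word_eval /mmul /mone /=.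
  by rewrite fmmulE big_cat.
by rewrite fmoneE big_nil.
Qed.
HB.instance Definition _ :=
  isMultiplicative.Build {fmonom bool} A word_eval word_eval_mmorphism.

Definition free_eval (f : free_alg) : A := mmap (in_alg A) word_eval f.

Lemma free_eval_zmod : zmod_morphism free_eval.
Proof. exact: mmap_is_additive. Qed.
HB.instance Definition _ :=
  GRing.isZmodMorphism.Build free_alg A free_eval free_eval_zmod.

Lemma free_eval_monoid : monoid_morphism free_eval.
Proof.
rewrite /free_eval; split; first exact: mmap1.
apply: (fun c => (@commr_mmap_is_multiplicative _ _ _ (in_alg A) word_eval c).1).
by move=> g m m'; rewrite /GRing.comm /= mulr_algl mulr_algr.
Qed.
HB.instance Definition _ :=
  GRing.isMonoidMorphism.Build free_alg A free_eval free_eval_monoid.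

Lemma free_evalZ : scalable free_eval.
Proof. by move=> c f; rewrite /free_eval mmapZ /= mulr_algl. Qed.
HB.instance Definition _ :=
  GRing.isScalable.Build k free_alg A *:%R free_eval free_evalZ.

Lemma free_evalx : free_eval free_x = a.
Proof.
by rewrite /free_eval mmapU /= scale1r mul1r /word_eval fmuE big_seq1.
Qed.

Lemma free_evaly : free_eval free_y = b.
Proof.
by rewrite /free_eval mmapU /= scale1r mul1r /word_eval fmuE big_seq1.
Qed.

Lemma free_eval_ideal f :
  a * b - b * a = b ^+ 2 -> f \in jordan_ideal -> free_eval f = 0.
Proof.
move=> rel_ab /jordan_idealP; elim=> [|f1 g1 _ I1 _ I2|c d].
- exact: raddf0.
- by rewrite raddfD /= I1 I2 addr0.
rewrite !rmorphM !rmorphB rmorphXn !rmorphM /= free_evalx free_evaly rel_ab.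
by rewrite subrr mulr0 mul0r.
Qed.
End Lift.

Lemma jordan_ideal1 : 1 \notin jordan_ideal.
Proof.
apply/negP=> I1; have rel0 : (0 : k^o) * 0 - 0 * 0 = 0 ^+ 2.
  by rewrite mulr0 subrr expr0n.
by have /eqP := free_eval_ideal rel0 I1; rewrite rmorph1 oner_eq0.
Qed.

(* The quotient: ring_quotient gives the additive group for any additive      *)
(* subgroup, but the product only for ideals of commutative rings.            *)
Local Open Scope quotient_scope.

Definition jordan_plane := {ideal_quot jordan_ideal}.
HB.instance Definition _ := GRing.Zmodule.on jordan_plane.
HB.instance Definition _ := EqQuotient.on jordan_plane.

Definition jp_one : jordan_plane := lift_cst jordan_plane 1.
Definition jp_mul := lift_op2 jordan_plane *%R.
Definition jp_scale c := lift_op1 jordan_plane ( *:%R c).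

Canonical pi_jp_one_morph := PiConst jp_one.

Lemma pi_jp_mul : {morph \pi_jordan_plane : x y / x * y >-> jp_mul x y}.
Proof.
move=> x y; unlock jp_mul; apply/eqP; rewrite piE Quotient.equivE.
set x' := repr _; set y' := repr _.
have Ix : x - x' \in jordan_ideal.
  by rewrite Quotient.idealrBE; apply/eqP; rewrite reprK.
have Iy : y - y' \in jordan_ideal.
  by rewrite Quotient.idealrBE; apply/eqP; rewrite reprK.
have -> : x * y - x' * y' = (x - x') * y + x' * (y - y').
  by rewrite mulrBl mulrBr addrA subrK.
by apply: rpredD; [apply: jordan_idealMr | apply: jordan_idealMl].
Qed.
Canonical pi_jp_mul_morph := PiMorph2 pi_jp_mul.

Lemma pi_jp_scale c : {morph \pi_jordan_plane : x / c *: x >-> jp_scale c x}.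
Proof.
move=> x; unlock jp_scale; apply/eqP; rewrite piE Quotient.equivE.
set x' := repr _.
have Ix : x - x' \in jordan_ideal.
  by rewrite Quotient.idealrBE; apply/eqP; rewrite reprK.
by rewrite -scalerBr -mulr_algl jordan_idealMl.
Qed.
Canonical pi_jp_scale_morph c := PiMorph1 (pi_jp_scale c).

Lemma jp_mulA : associative jp_mul.
Proof. by move=> x y z; rewrite -[x]reprK -[y]reprK -[z]reprK !piE mulrA. Qed.
Lemma jp_mul1r : left_id jp_one jp_mul.
Proof. by move=> x; rewrite -[x]reprK !piE mul1r. Qed.
Lemma jp_mulr1 : right_id jp_one jp_mul.
Proof. by move=> x; rewrite -[x]reprK !piE mulr1. Qed.
Lemma jp_mulDl : left_distributive jp_mul +%R.
Proof.
by move=> x y z; rewrite -[x]reprK -[y]reprK -[z]reprK !piE mulrDl.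
Qed.
Lemma jp_mulDr : right_distributive jp_mul +%R.
Proof.
by move=> x y z; rewrite -[x]reprK -[y]reprK -[z]reprK !piE mulrDr.
Qed.
Lemma jp_1_neq0 : jp_one != 0.
Proof. by rewrite piE Quotient.equivE subr0 jordan_ideal1. Qed.
HB.instance Definition _ := GRing.Zmodule_isNzRing.Build jordan_plane
  jp_mulA jp_mul1r jp_mulr1 jp_mulDl jp_mulDr jp_1_neq0.

Lemma jp_scaleA c d (f : jordan_plane) :
  jp_scale c (jp_scale d f) = jp_scale (c * d) f.
Proof. by rewrite -[f]reprK !piE scalerA. Qed.
Lemma jp_scale1 : left_id 1 jp_scale.
Proof. by move=> f; rewrite -[f]reprK !piE scale1r. Qed.
Lemma jp_scaleDr : right_distributive jp_scale +%R.
Proof. by move=> c f g; rewrite -[f]reprK -[g]reprK !piE scalerDr. Qed.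
Lemma jp_scaleDl f : {morph jp_scale^~ f : c d / c + d}.
Proof. by move=> c d; rewrite -[f]reprK !piE scalerDl. Qed.
HB.instance Definition _ := GRing.Zmodule_isLmodule.Build k jordan_plane
  jp_scaleA jp_scale1 jp_scaleDr jp_scaleDl.

Lemma jp_scalerAl c (f g : jordan_plane) : c *: (f * g) = c *: f * g.
Proof.
by rewrite /GRing.scale /GRing.mul /= -[f]reprK -[g]reprK !piE scalerAl.
Qed.
HB.instance Definition _ :=
  GRing.Lmodule_isLalgebra.Build k jordan_plane jp_scalerAl.
Lemma jp_scalerAr c (f g : jordan_plane) : c *: (f * g) = f * (c *: g).
Proof.
by rewrite /GRing.scale /GRing.mul /= -[f]reprK -[g]reprK !piE scalerAr.
Qed.
HB.instance Definition _ :=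
  GRing.Lalgebra_isAlgebra.Build k jordan_plane jp_scalerAr.

Definition jp_x : jordan_plane := \pi free_x.
Definition jp_y : jordan_plane := \pi free_y.

Lemma pi_jordan_plane_eq (f g : free_alg) :
  (\pi_jordan_plane f == \pi_jordan_plane g) = (f - g \in jordan_ideal).
Proof. by rewrite Quotient.idealrBE. Qed.

Lemma jordan_plane_rel : jp_x * jp_y - jp_y * jp_x = jp_y ^+ 2.
Proof.
rewrite expr2 /GRing.mul /= /jp_x /jp_y !piE; apply/eqP.
rewrite pi_jordan_plane_eq; apply/jordan_idealP.
by rewrite -expr2 -[_ - _]mul1r -[1 * _]mulr1; constructor.
Qed.

Lemma jordan_plane_lift (A : algType k) (a b : A) :
  a * b - b * a = b ^+ 2 ->
  exists phi : {lrmorphism jordan_plane -> A}, phi jp_x = a /\ phi jp_y = b.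
Proof.
move=> rel_ab; pose phi (f : jordan_plane) := free_eval a b (repr f).
have phiE f : phi (\pi f) = free_eval a b f.
  apply/eqP; rewrite -subr_eq0 -raddfB; apply/eqP.
  apply: free_eval_ideal => //; rewrite -pi_jordan_plane_eq.
  by apply/eqP; rewrite reprK.
have phi_zmod : zmod_morphism phi.
  move=> f g; rewrite -[f]reprK -[g]reprK !piE !phiE; exact: raddfB.
have phi_monoid : monoid_morphism phi.
  split=> [|f g]; first by rewrite /GRing.one /= piE phiE rmorph1.
  rewrite -[f]reprK -[g]reprK [X in phi X]/GRing.mul /= !piE !phiE.
  exact: rmorphM.
have phi_scal : scalable phi.
  move=> c f; rewrite -[f]reprK [X in phi X]/GRing.scale /= !piE !phiE.
  exact: linearZ.
pose h1 := GRing.isZmodMorphism.Build _ _ phi phi_zmod.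
pose h2 := GRing.isMonoidMorphism.Build _ _ phi phi_monoid.
pose h3 := GRing.isScalable.Build _ _ _ _ phi phi_scal.
pose phiL : {lrmorphism jordan_plane -> A} := HB.pack phi h1 h2 h3.
by exists phiL; rewrite /= !phiE free_evalx free_evaly.
Qed.
End FreeAlgebra.

Section Representations.
Variables (k : fieldType) (n : nat).

(* An algebra homomorphism R -> M_n(k). It is not packaged as an lrmorphism   *)
(* since 'M_n is only an algType in positive dimension.                       *)
Record representation := Representation {
  rep_linear :> {linear jordan_plane k -> 'M[k]_n};
  rep_monoid : monoid_morphism rep_linear
}.

Definition rep_iso (rho rho' : representation) :=
  exists2 P : 'M[k]_n, P \in unitmx & forall r, P *m rho r = rho' r *m P.
End Representations.

Section NormalForm.
Variable k : fieldType.

Definition jordan_block p : 'M[k]_p := \matrix_(i, j) (i.+1 == j :> nat)%:R.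

(* First upper diagonal (0, 1, ..., p - 2): row indices start at 0 here.      *)
Definition X0 p : 'M[k]_p := \matrix_(i, j) (i%:R *+ (i.+1 == j :> nat)).

Definition upper_toeplitz p q (A : 'M[k]_(p, q)) :=
  (forall (s s' : 'I_p) (t t' : 'I_q),
     t%:Z - s%:Z = t'%:Z - s'%:Z -> A s t = A s' t') /\
  (forall (s : 'I_p) (t : 'I_q),
     t%:Z - s%:Z < Num.max 0 (q%:Z - p%:Z) -> A s t = 0).

Section Blocks.
Variables (m : nat) (p : 'I_m -> nat).

Definition jordan_diag : 'M[k]_(\sum_i p i) := \mxdiag_i jordan_block (p i).

(* X0 enters with a minus sign: X0 *m J - J *m X0 = - J *m J for the Jordan   *)
(* block J, so T - X0 rather than T + X0 solves X Y - Y X = Y ^ 2.            *)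
Definition toeplitz_blocks (X : 'M[k]_(\sum_i p i)) :=
  (forall i, exists2 T : 'M[k]_(p i),
     upper_toeplitz T & submxblock X i i = T - X0 (p i)) /\
  (forall i j, i != j -> upper_toeplitz (submxblock X i j)).
End Blocks.

Definition normal_pair n (X Y : 'M[k]_n) :=
  exists m (p : 'I_m -> nat) (e : (\sum_i p i)%N = n),
    [/\ forall i, (0 < p i)%N,
        Y = castmx (e, e) (jordan_diag p)
      & toeplitz_blocks (castmx (esym e, esym e) X)].
End NormalForm.

Arguments jp_x {k}.
Arguments jp_y {k}.
Arguments jordan_diag k {m} p.

(* Main.v *)
From HB Require Import structures.
Require Import Defs.
From mathcomp Require Import all_boot all_order all_algebra.
From mathcomp Require Import zify.

Set Implicit Arguments.
Unset Strict Implicit.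
Unset Printing Implicit Defensive.

Import Order.TTheory GRing.Theory Num.Theory.
Local Open Scope ring_scope.

(** A representation amounts to a pair (X, Y) with X Y - Y X = Y ^ 2
    ([representation_rel], [representation_of_rel]).

    The commutator with X acts on polynomials in Y as the derivation Y ^ 2 d/dY.
    Applied to the minimal polynomial of Y this forces, in characteristic 0, the
    minimal polynomial to be a power of the variable, so that Y is nilpotent
    ([jordan_relation_nilpotent]). A nilpotent matrix has a Jordan form
    ([nilpotent_jordan_form]); conjugating the representation by the
    corresponding base change gives Y = diag (J_{n_1}, ..., J_{n_m}).

    For such a Y the relation is an inhomogeneous linear equation for X. One
    solution is the block diagonal matrix with blocks - X0, and the solutions of
    the homogeneous equation X Y = Y X are the matrices whose blocks are upper
    Toeplitz ([upper_toeplitzP]). Adding the two gives exactly the normal forms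
    ([toeplitz_blocksP]). *)

(** * Matrices intertwining Jordan blocks *)

Section Toeplitz.
Variable k : fieldType.

Lemma mulmx_jordanS p q (A : 'M[k]_(p, q)) s (t t' : 'I_q) :
  t.+1 = t' :> nat -> (A *m jordan_block k q) s t' = A s t.
Proof.
move=> tt'; rewrite mxE (bigD1 t) //= mxE tt' eqxx mulr1 big1 ?addr0 // => j nj.
by rewrite mxE -tt' eqSS (inj_eq val_inj) (negPf nj) mulr0.
Qed.

Lemma mulmx_jordan0 p q (A : 'M[k]_(p, q)) s (t : 'I_q) :
  t = 0 :> nat -> (A *m jordan_block k q) s t = 0.
Proof. by move=> t0; rewrite mxE big1 // => j _; rewrite mxE t0 mulr0. Qed.

Lemma jordan_mulmxS p q (A : 'M[k]_(p, q)) (s s' : 'I_p) t :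
  s.+1 = s' :> nat -> (jordan_block k p *m A) s t = A s' t.
Proof.
move=> ss'; rewrite mxE (bigD1 s') //= mxE ss' eqxx mul1r big1 ?addr0 // => j.
by rewrite mxE ss' -(inj_eq val_inj) eq_sym => /negPf->; rewrite mul0r.
Qed.

Lemma jordan_mulmx_last p q (A : 'M[k]_(p, q)) (s : 'I_p) t :
  s.+1 = p -> (jordan_block k p *m A) s t = 0.
Proof.
move=> sp; rewrite mxE big1 // => j _; rewrite mxE sp gtn_eqF ?mul0r //.
Qed.

(** Upper Toeplitz matrices are the intertwiners of two Jordan blocks: right
    multiplication by a block shifts columns to the right and left
    multiplication shifts rows up, so intertwining means that entries agree
    along diagonals, while the zeros shifted into the first column and the last
    row kill every diagonal that starts in the first column below the top row
    or ends in the last row before the last column. *)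
Lemma upper_toeplitzP p q (A : 'M[k]_(p, q)) :
  upper_toeplitz A <-> A *m jordan_block k q = jordan_block k p *m A.
Proof.
split=> [[TA A0]|comA].
  apply/matrixP=> s t; have [t0|t_gt0] := posnP t.
    rewrite mulmx_jordan0 //; have [sp|/ltnSE] := ltnP s.+1 p; last first.
      move=> ps; rewrite jordan_mulmx_last //; apply/eqP.
      by rewrite eqn_leq ps ltn_ord.
    rewrite (@jordan_mulmxS _ _ _ _ (Ordinal sp)) // A0 //= lt_max; lia.
  have lt_t1 : (t.-1 < q)%N by rewrite (leq_ltn_trans (leq_pred t)).
  rewrite (@mulmx_jordanS _ _ _ _ (Ordinal lt_t1)) /= ?prednK //.
  have [sp|ps] := ltnP s.+1 p.
    by rewrite (@jordan_mulmxS _ _ _ _ (Ordinal sp)) //; apply: TA => /=; lia.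
  rewrite jordan_mulmx_last; last by have := ltn_ord s; lia.
  by apply: A0; rewrite lt_max /=; have := ltn_ord s; have := ltn_ord t; lia.
have shift1 (s s' : 'I_p) (t t' : 'I_q) :
    s.+1 = s' :> nat -> t.+1 = t' :> nat -> A s t = A s' t'.
  move=> ss' tt'; have := congr1 (fun M : 'M_(p, q) => M s t') comA.
  by rewrite /= (mulmx_jordanS _ _ tt') (jordan_mulmxS _ _ ss').
have shift d : forall (s s' : 'I_p) (t t' : 'I_q),
    (s + d = s')%N -> (t + d = t')%N -> A s t = A s' t'.
  elim: d => [|d IHd] s s' t t' es et.
    by congr (A _ _); apply: val_inj; rewrite /= -?es -?et addn0.
  have lt_s : (s + d < p)%N by have := ltn_ord s'; lia.
  have lt_t : (t + d < q)%N by have := ltn_ord t'; lia.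
  rewrite (IHd s (Ordinal lt_s) t (Ordinal lt_t)) //.
  by apply: shift1 => /=; lia.
split=> [s s' t t' e|s t].
  have [le_s|/ltnW le_s] := leqP s s'.
    by apply: (shift (s' - s)%N); lia.
  by apply/esym/(shift (s - s')%N); lia.
(* The diagonal t - s < 0 starts in the first column below the top row, and  *)
(* the diagonal t - s < q - p ends in the last row before the last column.   *)
rewrite lt_max => /orP[lt_ts|lt_qp].
  have lt_d : (s - t < p)%N by have := ltn_ord s; lia.
  have lt_0 : (0 < q)%N := leq_ltn_trans (leq0n t) (ltn_ord t).
  have lt_d1 : ((s - t).-1 < p)%N by lia.
  rewrite -(shift t (Ordinal lt_d) s (Ordinal lt_0) t) /=; try lia.
  rewrite -(@jordan_mulmxS _ _ _ (Ordinal lt_d1)) /=; last lia.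
  by rewrite -comA mulmx_jordan0.
have lt_p : (p.-1 < p)%N by have := ltn_ord s; lia.
have lt_u : (t + (p.-1 - s) < q)%N by have := ltn_ord s; lia.
have lt_u1 : ((t + (p.-1 - s)).+1 < q)%N by have := ltn_ord s; lia.
rewrite (shift (p.-1 - s)%N s (Ordinal lt_p) t (Ordinal lt_u)) /=;
  try lia; last first.
  by have := ltn_ord s; lia.
rewrite -(@mulmx_jordanS _ _ _ _ _ (Ordinal lt_u1)) //.
by rewrite comA jordan_mulmx_last //=; lia.
Qed.

(** With indices starting at 0, the entry (i, i + 2) of X0 J is i and that of
    J X0 is i + 1; hence - X0 is a particular solution of X J - J X = J ^ 2. *)
Lemma X0_commutator p :
  X0 k p *m jordan_block k p - jordan_block k p *m X0 k p =
  - (jordan_block k p *m jordan_block k p).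
Proof.
apply/matrixP=> s t; rewrite !mxE -sumrB -sumrN; apply: eq_bigr => j _.
rewrite !mxE; case: eqP => [<-|_]; last by rewrite !mul0r subrr oppr0.
rewrite !mulr1n !mul1r; case: eqP => _; rewrite ?mulr0n ?mulr0 ?subrr ?oppr0 //.
by rewrite mulr1 mulr1n -natr1 opprD addrA subrr add0r.
Qed.

(** Blockwise, the relation is a linear equation in X: off the diagonal it is
    homogeneous, X_ij J_j = J_i X_ij, and on the diagonal it has the particular
    solution - X0; [upper_toeplitzP] solves the homogeneous equation. *)
Lemma toeplitz_blocksP m (p : 'I_m -> nat) (X : 'M[k]_(\sum_i p i)) :
  toeplitz_blocks X <->
  X *m jordan_diag k p - jordan_diag k p *m X =
  jordan_diag k p *m jordan_diag k p.
Proof.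
set J := fun i => jordan_block k (p i).
have commE :
    X *m jordan_diag k p - jordan_diag k p *m X =
    \mxblock_(i, j) (submxblock X i j *m J j - J i *m submxblock X i j).
  by rewrite mxblockB -mul_mxblock_mxdiag -mul_mxdiag_mxblock submxblockK.
have sqrE :
    jordan_diag k p *m jordan_diag k p =
    \mxblock_(i, j) (J i *m if i == j then conform_mx 0 (J i) else 0).
  by rewrite -mul_mxdiag_mxblock.
have diagP i :
    (exists2 T, upper_toeplitz T & submxblock X i i = T - X0 k (p i)) <->
    submxblock X i i *m J i - J i *m submxblock X i i = J i *m J i.
  split=> [[T /upper_toeplitzP comT ->]|relX].
    rewrite mulmxBl mulmxBr comT opprB addrC addrA subrK -[RHS]opprK.
    by rewrite -X0_commutator opprB.
  exists (submxblock X i i + X0 k (p i)); last by rewrite addrK.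
  apply/upper_toeplitzP/eqP; rewrite -subr_eq0 mulmxDl mulmxDr opprD addrACA.
  by rewrite relX X0_commutator subrr.
rewrite commE sqrE -eq_mxblockP.
split=> [[Xd Xo] i j|relX].
  have [<-|ne_ij] := eqVneq i j; first by rewrite conform_mx_id; apply/diagP.
  by rewrite mulmx0; apply/eqP; rewrite subr_eq0; apply/eqP/upper_toeplitzP/Xo.
split=> [i|i j ne_ij].
  by apply/diagP; rewrite relX eqxx conform_mx_id.
apply/upper_toeplitzP/eqP; rewrite -subr_eq0 relX (negPf ne_ij) mulmx0 //.
Qed.
End Toeplitz.

(** * Nilpotency of Y *)

Section Nilpotency.
Variables (k : fieldType) (char0 : [pchar k] =i pred0).

(** The commutator with X is a derivation that sends Y to Y ^ 2, so on
    polynomials in Y it acts as Y ^ 2 d/dY. *)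
Lemma commutator_horner n (X Y : 'M[k]_n.+1) (q : {poly k}) :
  X * Y - Y * X = Y ^+ 2 ->
  X * horner_mx Y q - horner_mx Y q * X = horner_mx Y q^`() * Y ^+ 2.
Proof.
move=> relXY; elim/poly_ind: q => [|q c IHq].
  by rewrite deriv0 rmorph0 mulr0 !mul0r subrr.
rewrite derivD derivC addr0 derivM derivX mulr1 !rmorphD !rmorphM /= horner_mx_X.
rewrite horner_mx_C; set R := horner_mx Y q; set R' := horner_mx Y q^`() in IHq *.
have -> : X * (R * Y + c%:M) - (R * Y + c%:M) * X =
    (X * R - R * X) * Y + R * (X * Y - Y * X).
  have cX : c%:M * X = X * c%:M by rewrite -!mulmxE scalar_mxC.
  rewrite mulrDr mulrDl cX opprD addrACA subrr addr0.
  by rewrite mulrBl mulrBr !mulrA addrA subrK.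
by rewrite IHq relXY mulrDl -(mulrA R' _ Y) -(mulrA R' Y) -exprSr -exprS.
Qed.

(** Commuting X with p(Y) = 0, for p the minimal polynomial of Y, shows that p
    divides 'X^2 * p'. Write p = q * 'X^a with q(0) nonzero: then q divides q',
    which in characteristic 0 forces q to be constant. *)
Lemma jordan_relation_nilpotent n (X Y : 'M[k]_n) :
  X *m Y - Y *m X = Y *m Y -> exists N, Y ^+ N = 0.
Proof.
case: n X Y => [|n] X Y relXY.
  by exists 0; rewrite [LHS]flatmx0 [RHS]flatmx0.
set p := mxminpoly Y.
have dvd_p : p %| p^`() * 'X^2.
  apply/mxminpoly_min; rewrite rmorphM rmorphXn /= horner_mx_X.
  by rewrite -(commutator_horner _ relXY) mx_root_minpoly mulr0 mul0r subrr.
have p_neq0 : p != 0 by apply/monic_neq0/mxminpoly_monic.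
have [a [q]] := multiplicity_XsubC p 0.
rewrite p_neq0 subr0 /= => q0 def_p; have q_neq0 : q != 0.
  by apply: contraNneq p_neq0 => q_eq0; rewrite def_p q_eq0 mul0r.
have dvd_q : q %| q^`().
  have coqX m : coprimep q 'X^m.
    by rewrite coprimep_expr // -['X]subr0 coprimep_XsubC.
  rewrite -(Gauss_dvdpl _ (coqX a)) -(Gauss_dvdpl _ (coqX 2)).
  have : q %| p^`() * 'X^2 by rewrite (dvdp_trans _ dvd_p) // def_p dvdp_mulr.
  rewrite def_p derivM mulrDl [q * _ * _]mulrAC dvdp_addl //.
  by rewrite -mulrA dvdp_mulr.
have q'0 : q^`() = 0.
  apply: contraTeq dvd_q => q'_neq0; apply/negP=> /(dvdp_leq q'_neq0).
  by rewrite leqNgt lt_size_deriv.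
have [c def_q] : exists c, q = c%:P.
  exists q`_0; apply: size1_polyC; rewrite leqNgt; apply/negP=> q_gt1.
  have := congr1 (fun f : {poly k} => f`_(size q).-2) q'0.
  rewrite /= coef_deriv coef0 => /eqP.
  have -> : (size q).-2.+1 = (size q).-1 by lia.
  rewrite -mulr_natr mulf_eq0 lead_coef_eq0 (negPf q_neq0) /=.
  by move/pcharf0P: char0 => ->; case: (size q) q_gt1 => [|[]].
exists a; have := mx_root_minpoly Y; rewrite -/p def_p def_q rmorphM rmorphXn /=.
rewrite horner_mx_C horner_mx_X -mulmxE mul_scalar_mx => /eqP.
rewrite scaler_eq0 => /orP[/eqP c0|/eqP //].
by rewrite def_q c0 eqxx in q_neq0.
Qed.
End Nilpotency.

(** * Jordan form of a nilpotent matrix *)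

Section Jordan.
Variable k : fieldType.

(** Let p be the nilpotency index of Y, and choose a row vector r and a column
    vector c with r Y^(p-1) c nonzero. The vectors r Y^i span a Jordan block, and
    the common kernel of the functionals Y^j c is a stable complement: the
    pairing matrix r Y^(i+j) c vanishes for i + j >= p and is nonzero for
    i + j = p - 1, so it is invertible. Here P has the rows of a basis adapted to
    this decomposition. *)
Lemma nilpotent_split_block n (Y : 'M[k]_n) N :
  (0 < n)%N -> Y ^+ N = 0 ->
  exists p n' (P : 'M[k]_(p + n', n)) (Y' : 'M[k]_n'),
    [/\ (0 < p)%N, (p + n')%N = n, row_free P,
        P *m Y = block_mx (jordan_block k p) 0 0 Y' *m P &
        exists N', Y' ^+ N' = 0].
Proof.
move=> n_gt0 YN; have exY : exists m, Y ^+ m == 0 by exists N; apply/eqP.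
have [p /eqP Yp min_p] := ex_minnP exY.
have p_gt0 : (0 < p)%N.
  rewrite lt0n; apply: contraTneq n_gt0 => p0; rewrite -leqNgt leqn0.
  apply/eqP; move: Yp; rewrite p0 expr0 => /(congr1 (@mxrank _ _ _)).
  by rewrite mxrank0 mxrank1.
have Yp0 m : (p <= m)%N -> Y ^+ m = 0.
  by move=> le_pm; rewrite -(subnKC le_pm) exprD Yp mul0r.
have [r [c a_neq0]] : exists r c, (Y ^+ p.-1) r c != 0.
  have /matrix0Pn// : Y ^+ p.-1 != 0.
  by apply/negP=> /min_p; lia.
pose a := (Y ^+ p.-1) r c; rewrite -/a in a_neq0.
pose B := \matrix_(i < p) row r (Y ^+ i).
(* The functionals are listed by decreasing powers of Y, which makes B *m C   *)
(* upper triangular and Y act on C by the Jordan block.                       *)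
pose C := \matrix_(i < n, j < p) (Y ^+ (p.-1 - j)) i c.
have BY : B *m Y = jordan_block k p *m B.
  apply/matrixP=> i j; have -> : (B *m Y) i j = (Y ^+ i.+1) r j.
    by rewrite exprSr -mulmxE !mxE; apply: eq_bigr => l _; rewrite !mxE.
  have [lt_ip|le_pi] := ltnP i.+1 p.
    by rewrite (@jordan_mulmxS _ _ _ _ _ (Ordinal lt_ip)) // !mxE.
  by rewrite Yp0 // jordan_mulmx_last ?mxE //; have := ltn_ord i; lia.
have YC : Y *m C = C *m jordan_block k p.
  apply/matrixP=> i j; have -> : (Y *m C) i j = (Y ^+ (p.-1 - j).+1) i c.
    by rewrite exprS -mulmxE !mxE; apply: eq_bigr => l _; rewrite !mxE.
  have [j0|j_gt0] := posnP j.
    by rewrite mulmx_jordan0 // Yp0 ?mxE // j0; lia.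
  have lt_j : (j.-1 < p)%N by have := ltn_ord j; lia.
  rewrite (@mulmx_jordanS _ _ _ _ _ (Ordinal lt_j)) /= ?prednK // mxE /=.
  by congr ((Y ^+ _) i c); have := ltn_ord j; lia.
have BC_unit : B *m C \in unitmx.
  have BCE i j : (B *m C) i j = (Y ^+ (i + (p.-1 - j))) r c.
    by rewrite exprD -mulmxE !mxE; apply: eq_bigr => l _; rewrite !mxE.
  rewrite unitmxE unitfE -det_tr det_trig.
    apply/prodf_neq0 => i _; rewrite mxE BCE.
    by have -> : (i + (p.-1 - i) = p.-1)%N by have := ltn_ord i; lia.
  apply/is_trig_mxP => i j lt_ij; rewrite mxE BCE Yp0 ?mxE //.
  by have := ltn_ord i; have := ltn_ord j; lia.
have [W W_free eqW] : exists2 W : 'M_(\rank (kermx C), n),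
    row_free W & (W :=: kermx C)%MS.
  by exists (row_base (kermx C)); [apply: row_base_free | apply: eq_row_base].
have WC : W *m C = 0 by apply/sub_kermxP; rewrite eqW.
have rkC : \rank C = p.
  apply/eqP; rewrite eqn_leq rank_leq_col -{1}(mxrank_unit BC_unit).
  by rewrite mxrankM_maxr.
have /submxP[Y' WY] : (W *m Y <= W)%MS.
  by rewrite eqW; apply/sub_kermxP; rewrite -mulmxA YC mulmxA WC mul0mx.
exists p, (\rank (kermx C)), (col_mx B W), Y'; split=> //.
- by rewrite mxrank_ker rkC subnKC // -rkC rank_leq_row.
- apply: inj_row_free => v; rewrite -(hsubmxK v) mul_row_col => BW0.
  have v1 : lsubmx v = 0.
    apply: (can_inj (mulmxK BC_unit)); have := congr1 (mulmx^~ C) BW0.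
    by rewrite /= mulmxDl -!(mulmxA _ _ C) WC mulmx0 addr0 !mul0mx.
  move: BW0; rewrite v1 mul0mx add0r => W0.
  by rewrite (row_free_inj W_free (etrans W0 (esym (mul0mx _ _)))) row_mx0.
- by rewrite mul_col_mx mul_block_col !mul0mx addr0 add0r BY WY.
exists p; apply: (row_free_inj W_free); rewrite mul0mx.
have WYi i : W *m Y ^+ i = Y' ^+ i *m W.
  elim: i => [|i IHi]; first by rewrite !expr0 mulmx1 mul1mx.
  by rewrite !exprSr -!mulmxE mulmxA IHi -!mulmxA WY.
by rewrite -WYi Yp mulmx0.
Qed.

(** Split off one cyclic block after another. *)
Lemma nilpotent_jordan_form n (Y : 'M[k]_n) N :
  Y ^+ N = 0 ->
  exists m (p : 'I_m -> nat) (e : (\sum_i p i)%N = n) (P : 'M[k]_n),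
    [/\ forall i, (0 < p i)%N, P \in unitmx &
        P *m Y = castmx (e, e) (jordan_diag k p) *m P].
Proof.
(* During the induction the block sizes form a sequence, so that prepending  *)
(* a size computes, and P stays rectangular, so that its rows are indexed by *)
(* the sum of the sizes without a cast to n.                                 *)
move=> YN; suff [s [P [s_gt0 s_n P_free PY]]] : exists (s : seq nat)
    (P : 'M_(\sum_(i < size s) nth 0%N s i, n)),
    [/\ forall i : 'I_(size s), (0 < nth 0%N s i)%N,
        (\sum_(i < size s) nth 0%N s i)%N = n, row_free P &
        P *m Y = jordan_diag k (fun i : 'I_(size s) => nth 0%N s i) *m P].
  exists (size s), (fun i => nth 0%N s i), s_n.
  case: _ / s_n P Y YN P_free PY => P Y _ P_free PY.
  by exists P; rewrite -row_free_unit castmx_id.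
have [b le_nb] := ubnP n; elim: b => // b IHb in n Y N le_nb YN *.
have [n0|n_gt0] := posnP n.
  exists [::], 0; split; first by case.
  - by rewrite big_ord0 n0.
  - apply: inj_row_free => v _; apply/rowP=> -[j lt_j].
    by exfalso; rewrite big_ord0 in lt_j.
  by apply/matrixP=> i [j lt_jn]; exfalso; rewrite n0 in lt_jn.
have [p [n' [P [Y' [p_gt0 pn' P_free PY [N' Y'N]]]]]] :=
  nilpotent_split_block n_gt0 YN.
have [|s [Q [s_gt0 s_n' Q_free QY]]] := IHb n' Y' N' _ Y'N; first by lia.
have [e JE] : exists e,
    jordan_diag k (fun i : 'I_(size (p :: s)) => nth 0%N (p :: s) i) =
    castmx (e, e) (block_mx (jordan_block k p) 0 0
      (jordan_diag k (fun i : 'I_(size s) => nth 0%N s i))).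
  by eexists; apply: mxdiag_recl.
pose U : 'M_(_, n) := block_mx 1%:M 0 0 Q *m P.
have U_free : row_free U.
  rewrite /U; apply: inj_row_free => v; rewrite mulmxA => vP0.
  have := row_free_inj P_free (etrans vP0 (esym (mul0mx _ _))).
  rewrite -[v]hsubmxK mul_row_block !mulmx0 mulmx1 addr0 add0r -row_mx0.
  case/eq_row_mx=> -> vQ0.
  by rewrite (row_free_inj Q_free (etrans vQ0 (esym (mul0mx _ _)))) row_mx0.
have UY : U *m Y = block_mx (jordan_block k p) 0 0
    (jordan_diag k (fun i : 'I_(size s) => nth 0%N s i)) *m U.
  rewrite /U -mulmxA PY !mulmxA !mulmx_block !mulmx0 !mul0mx !addr0 !add0r.
  by rewrite mul1mx mulmx1 QY.
exists (p :: s), (castmx (e, erefl) U); split.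
- by case=> [[|i] lt_i] //=; apply: (s_gt0 (Ordinal (lt_i : (i < size s)%N))).
- by rewrite -e s_n'.
- by move: e {JE}; rewrite /=; case: _ /; rewrite castmx_id.
rewrite JE; move: e {JE}; rewrite /=; case: _ /; rewrite !castmx_id.
exact: UY.
Qed.
End Jordan.

(** * Representations as pairs of matrices *)

Section Representations.
Variable k : fieldType.

Lemma representation_rel n (rho : representation k n) :
  rho jp_x *m rho jp_y - rho jp_y *m rho jp_x = rho jp_y *m rho jp_y.
Proof.
have [_ rhoM] := rep_monoid rho.
have <- : rho (jp_y ^+ 2) = rho jp_y *m rho jp_y by apply: rhoM.
by rewrite -jordan_plane_rel raddfB; congr (_ - _); apply/esym/rhoM.
Qed.

(** This is the universal property of R. Since it speaks of nontrivial algebras,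
    the zero-dimensional representation is built separately. *)
Lemma representation_of_rel n (X Y : 'M[k]_n) :
  X *m Y - Y *m X = Y *m Y ->
  exists rho : representation k n, rho jp_x = X /\ rho jp_y = Y.
Proof.
case: n X Y => [|n] X Y relXY.
  have zero_monoid : monoid_morphism (\0 : jordan_plane k -> 'M[k]_0).
    by split=> [|f g]; rewrite [LHS]flatmx0 [RHS]flatmx0.
  by exists (Representation zero_monoid); rewrite [X]flatmx0 [Y]flatmx0.
have [phi [phix phiy]] := jordan_plane_lift (relXY : X * Y - Y * X = Y ^+ 2).
have phi_monoid : monoid_morphism (phi : jordan_plane k -> 'M[k]_n.+1).
  by split; [apply: rmorph1 | apply: rmorphM].
by exists (@Representation _ _ (phi : {linear _ -> _}) phi_monoid).
Qed.

(** Isomorphic representations are obtained by transport of structure along any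
    invertible matrix, which makes it possible to choose the Jordan basis. *)
Lemma representation_conj n (rho : representation k n) (P : 'M[k]_n) :
  P \in unitmx ->
  exists2 rho' : representation k n, rep_iso rho rho' &
    rho' jp_x = P *m rho jp_x *m invmx P /\ rho' jp_y = P *m rho jp_y *m invmx P.
Proof.
move=> Pu; pose f r := P *m rho r *m invmx P.
have f_zmod : zmod_morphism f.
  by move=> a b; rewrite /f raddfB mulmxBr mulmxBl.
have f_scal : scalable f.
  by move=> c a; rewrite /f linearZ /= -scalemxAr -scalemxAl.
have [rho1 rhoM] := rep_monoid rho.
have f_monoid : monoid_morphism f.
  split=> [|a b]; first by rewrite /f rho1 mulmx1 mulmxV.
  by rewrite /f rhoM -!mulmxE !mulmxA mulmxKV.
pose h1 := GRing.isZmodMorphism.Build _ _ f f_zmod.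
pose h3 := GRing.isScalable.Build _ _ _ _ f f_scal.
pose fL : {linear jordan_plane k -> 'M[k]_n} := HB.pack f h1 h3.
exists (@Representation _ _ fL f_monoid) => //.
by exists P => // r; rewrite /= /f mulmxKV.
Qed.
End Representations.

(** * The classification *)

Theorem theorem4p1 (k : closedFieldType) (char0 : [pchar k] =i pred0) (n : nat) :
  (* every representation is isomorphic to one given by a pair in normal form *)
  (forall rho : representation k n, exists2 rho' : representation k n,
     rep_iso rho rho' & normal_pair (rho' jp_x) (rho' jp_y)) /\
  (* for Y in Jordan form, the pairs (X, Y) coming from a representation are
     exactly those in normal form *)
  (forall (m : nat) (p : 'I_m -> nat) (e : (\sum_i p i)%N = n),
     (forall i, (0 < p i)%N) ->
     forall X : 'M[k]_n,
       (exists rho : representation k n,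
          rho jp_x = X /\ rho jp_y = castmx (e, e) (jordan_diag k p)) <->
       toeplitz_blocks (castmx (esym e, esym e) X)).
Proof.
have repP (m : nat) (p : 'I_m -> nat) (e : (\sum_i p i)%N = n) (X : 'M[k]_n) :
    (exists rho : representation k n,
       rho jp_x = X /\ rho jp_y = castmx (e, e) (jordan_diag k p)) <->
    toeplitz_blocks (castmx (esym e, esym e) X).
  case: _ / e X => X; rewrite !castmx_id toeplitz_blocksP.
  split=> [[rho [<- <-]]|]; [exact: representation_rel |].
  exact: representation_of_rel.
split=> [rho|m p e _ X]; last exact: repP.
have [N YN] := jordan_relation_nilpotent char0 (representation_rel rho).
have [m [p [e [P [p_gt0 P_unit PY]]]]] := nilpotent_jordan_form YN.
have [rho' iso_rho [_ rho'y]] := representation_conj rho P_unit.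
rewrite PY mulmxK // in rho'y.
exists rho' => //; exists m, p, e; split=> //.
by apply/repP; exists rho'.
Qed.
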